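(* Let $\Delta,w,h,s_1,\dots,s_h\in\mathbb N$ be such that $s_i\geq \max\{s_{i-1}/2, s_{i+1}/2\}$ for each $i\in[h]$ (terms with index $0$ or $h+1$ being omitted), and let $0<\delta<1$. For each $i\in[h]$ define $m_i=\delta^{-1/\Delta}3^{30\Delta w}s_i$, $b_i = 3^{6\Delta w}m_i$ and $a_i = 3^{10\Delta w}b_i$. Let $T$ be a tournament on $N\geq \sum_{i=1}^h 6a_i$ vertices. Then there exist pairwise disjoint sets $B_1,\dots,B_h\subseteq V(T)$ and, for each $i\in[h]$, sets $B_{i,0}\subseteq B_{i,1}\subseteq\dots\subseteq B_{i,w}\subseteq B_i$ such that, setting $B_0=\emptyset$, for each $i\in[h]$ and $j\in[w]$: (1) $m_i\leq |B_{i,j}|\leq b_i$, and (2) $(B_{i-1}\cup B_{i,j-1},\emptyset)$ is a $\big(B_{i,j},\Delta,s_i,\delta\,(\tfrac{s_i}{2b_i})^{\Delta}\binom{m_i/3}{\Delta}\big)$-out-community.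
   Context: For a digraph $T$ and $U\subseteq V(T)$, $N^+(U)$ denotes the common out-neighbourhood of $U$ (the set of vertices $x$ with $ux\in E(T)$ for all $u\in U$; $N^+(\emptyset)=V(T)$). For $A,C,R\subseteq V(T)$, $(A,C)$ is an $(R,\Delta,s,e)$-out-community if $|N^+(C)\cap R|\geq s+1$, $|A\setminus C|\geq\Delta$, and for all but at most $e$ subsets $S\subseteq A\setminus C$ with $|S|=\Delta$ we have $|N^+(C\cup S)\cap R|\geq s+1$. Floors and ceilings of non-integral quantities (such as $m_i/3$) are omitted, as in the paper. *)

(* Defs.v *)
From HB Require Import structures.
From mathcomp Require Import all_boot all_order all_algebra.
From mathcomp Require Import reals exp.

Set Implicit Arguments.
Unset Strict Implicit.
Unset Printing Implicit Defensive.

Import Order.TTheory GRing.Theory Num.Theory.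
Local Open Scope ring_scope.

(* A digraph on the finite vertex type V is its edge relation: [E x y] means
   that xy is an edge, oriented from x to y. *)

Definition tournament (V : finType) (E : rel V) : Prop :=
  irreflexive E /\ forall x y : V, x != y -> E x y (+) E y x.

Definition common_out (V : finType) (E : rel V) (U : {set V}) : {set V} :=
  [set x | [forall u in U, E u x]].

(* The error e is real: in the application it is not an integer. *)
Definition out_community (R : realType) (V : finType) (E : rel V)
    (A C Q : {set V}) (Delta s : nat) (e : R) : Prop :=
  [/\ (s + 1 <= #|common_out E C :&: Q|)%N,
      (Delta <= #|A :\: C|)%N
    & #|[set S : {set V} | [&& S \subset A :\: C, #|S| == Delta
          & ~~ (s + 1 <= #|common_out E (C :|: S) :&: Q|)%N]]|%:R <= e].

Definition m_of (R : realType) (delta : R) (Delta w s : nat) : R :=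
  delta `^ (- (Delta%:R)^-1) * 3 ^+ (30 * Delta * w) * s%:R.

Definition b_of (R : realType) (delta : R) (Delta w s : nat) : R :=
  3 ^+ (6 * Delta * w) * m_of delta Delta w s.

Definition a_of (R : realType) (delta : R) (Delta w s : nat) : R :=
  3 ^+ (10 * Delta * w) * b_of delta Delta w s.

(* m / 3 need not be an integer; the binomial coefficient is taken at its
   integer part (m is nonnegative, so truncn is the floor). *)
Definition err_of (R : realType) (delta : R) (Delta w s : nat) : R :=
  delta * (s%:R / (2 * b_of delta Delta w s)) ^+ Delta
        * 'C(Num.truncn (m_of delta Delta w s / 3), Delta)%:R.

(* Main.v *)
(* Take a median order of the tournament. From consecutive short windows of it one
   extracts disjoint sets X_1, ..., X_h such that every vertex of X_{i+1} has at
   least a third of X_i as in-neighbours. The sets B_i, of prescribed size inside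
   X_i, are found for i = h, ..., 1. Inside B_i one picks vertices one at a time,
   each time passing to the in-neighbourhood of the chosen vertex v. A third of the
   vertices have in-degree at least a third, and a set S with at most s common
   out-neighbours survives (S stays in the in-neighbourhood of v) for at most s
   choices of v, so 2 Delta such choices leave a proportion O((s/m)^(2 Delta)) of
   the bad sets; w blocks of 2 Delta choices give B_{i,w}, ..., B_{i,0}. All chosen
   vertices must moreover have a large common in-neighbourhood in X_{i-1}, which
   will contain B_{i-1}. For this B_{i,w} is taken in the common out-neighbourhood
   of a random tuple of X_{i-1}, and the choices are made simultaneously for as many
   tuples as possible. *)
Require Import Defs.
From HB Require Import structures.
From mathcomp Require Import all_boot all_order all_algebra.
From mathcomp Require Import reals exp.
From mathcomp Require Import zify ring lra.

Set Implicit Arguments.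
Unset Strict Implicit.
Unset Printing Implicit Defensive.

Import Order.TTheory GRing.Theory Num.Theory.
Local Open Scope nat_scope.

(** * Choosing vertices with large in-neighbourhoods *)

Lemma card_set_sum (T : finType) (A : {set T}) (p : pred T) :
  #|[set x in A | p x]| = \sum_(x in A) p x.
Proof.
rewrite -sum1_card big_mkcond [RHS]big_mkcond; apply: eq_bigr => x _.
by rewrite inE; case: (x \in A); case: (p x).
Qed.

Lemma double_count (T U : finType) (A : {set T}) (B : {set U}) (p : T -> U -> bool) :
  \sum_(x in A) #|[set y in B | p x y]| = \sum_(y in B) #|[set x in A | p x y]|.
Proof.
under eq_bigr => x _ do rewrite card_set_sum.
rewrite exchange_big /=.
by under [RHS]eq_bigr => x _ do rewrite card_set_sum.
Qed.

Lemma markov_count (T : finType) (A : {set T}) (f : T -> nat) (c : nat) :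
  #|[set x in A | c < f x]| * c <= \sum_(x in A) f x.
Proof.
rewrite card_set_sum big_distrl /=; apply: leq_sum => x _.
by case: ltnP => [/ltnW|]; rewrite ?mul1n ?mul0n.
Qed.

Lemma exists_ge_average (T : finType) (A : {set T}) (f : T -> nat) (a : nat) :
  0 < #|A| -> a <= \sum_(x in A) f x -> exists2 x, x \in A & a <= f x * #|A|.
Proof.
move=> A0 ha.
have [x xA hx] : exists2 x, x \in A & forall y, y \in A -> f y <= f x.
  case/card_gt0P: A0 => x0 x0A.
  by case: (@arg_maxnP _ x0 (mem A) f x0A) => x xA hx; exists x.
exists x => //; apply: leq_trans ha _.
rewrite mulnC -sum_nat_const; exact: leq_sum.
Qed.

Section VertexChoice.
Variables (V : finType) (E : rel V).

Definition common_in (C : {set V}) : {set V} := [set u | [forall v in C, E u v]].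

Lemma common_inP (C : {set V}) u :
  reflect (forall v, v \in C -> E u v) (u \in common_in C).
Proof. by rewrite inE; apply: (iffP forall_inP). Qed.

Lemma common_inU (C D : {set V}) : common_in (C :|: D) = common_in C :&: common_in D.
Proof.
apply/setP => u; rewrite in_setI; apply/common_inP/andP => [h|[/common_inP h1 /common_inP h2]].
  by split; apply/common_inP => v hv; apply: h; rewrite inE hv ?orbT.
by move=> v; rewrite inE => /orP[/h1|/h2].
Qed.

Lemma common_in1 v u : (u \in common_in [set v]) = E u v.
Proof.
apply/common_inP/idP => [|h x]; first by apply; rewrite inE.
by rewrite inE => /eqP ->.
Qed.

Lemma common_outP (C : {set V}) u :
  reflect (forall v, v \in C -> E v u) (u \in common_out E C).
Proof. by rewrite inE; apply: (iffP forall_inP). Qed.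

Hypothesis tournE : tournament E.

Lemma tournament_edges (Z : {set V}) :
  (\sum_(v in Z) #|[set u in Z | E u v]|).*2 = #|Z| * #|Z|.-1.
Proof.
rewrite -addnn {1}double_count -big_split /=.
transitivity (\sum_(v in Z) #|Z|.-1); last by rewrite sum_nat_const.
apply: eq_bigr => v vZ; rewrite (cardsD1 v Z) vZ add1n /=.
have -> : Z :\ v = [set u in Z | E v u] :|: [set u in Z | E u v].
  apply/setP => u; rewrite !inE; case: eqP => [->|/eqP uv]; first by rewrite tournE.1 andbF.
  by case: (u \in Z) => //=; move: (tournE.2 _ _ uv); case: (E u v); case: (E v u).
rewrite cardsU -[LHS]subn0; congr (_ - _); apply/esym/eqP; rewrite cards_eq0.
apply/eqP/setP => u; rewrite !inE; case: (u \in Z) => //=.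
case: (eqVneq u v) => [->|uv]; first by rewrite tournE.1.
by move: (tournE.2 _ _ uv); case: (E u v); case: (E v u).
Qed.

(** The vertices of low in-degree induce a tournament on [Z], whose average in-degree is
    [(#|Z| - 1) / 2]. As their in-degrees stay below a third of [#|D|], [Z] takes up at most about
    two thirds of [D]. *)
Lemma large_indegree (D : {set V}) :
  #|D| <= 3 * #|[set v in D | #|D| <= 3 * #|[set u in D | E u v]|]| + 1.
Proof.
set G := [set v in D | _]; set Z := D :\: G.
have ZD : Z \subset D by apply: subsetDl.
have DZ : #|D| = #|Z| + #|G|.
  by rewrite addnC -(cardsID G D); congr (_ + _); apply: eq_card => v; rewrite !inE;
     case: (v \in D).
have degZ v : v \in Z -> 3 * #|[set u in Z | E u v]| <= #|D|.-1.
  rewrite !inE => /andP[h vD]; rewrite vD /= -ltnNge in h.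
  suff : #|[set u in Z | E u v]| <= #|[set u in D | E u v]| by lia.
  apply/subset_leq_card/subsetP => u; rewrite !inE => /andP[/andP[_ ->]]; exact.
have := tournament_edges Z.
have : 3 * (\sum_(v in Z) #|[set u in Z | E u v]|) <= #|Z| * #|D|.-1.
  by rewrite big_distrr /= -sum_nat_const; apply: leq_sum.
rewrite DZ; move: #|Z| #|G| (\sum_(v in Z) _) => z g S h1 h2.
case: z h1 h2 => [|z] h1 h2; nia.
Qed.

(** A set [S] lies in the in-neighbourhood of [v] exactly when [v] is a common out-neighbour of [S],
    so on average over [D] at most [#|F| * s / #|D|] sets survive. By Markov's inequality at most a
    ninth of [D] exceeds nine times this average. These vertices are removed from the third given by
    [large_indegree]; [3 <= #|D|] absorbs the rounding. *)
Lemma many_good_vertices (D : {set V}) (F : {set {set V}}) (s : nat) :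
  3 <= #|D| -> (forall S, S \in F -> #|common_out E S :&: D| <= s) ->
  #|D| <= 9 * #|[set v in D | (#|D| <= 3 * #|D :&: common_in [set v]|)
     && (#|[set S in F | S \subset common_in [set v]]| * #|D| <= #|F| * (9 * s))]|.
Proof.
move=> D3 Fs.
set f := fun v => #|[set S in F | S \subset common_in [set v]]|.
set G1 := [set v in D | #|D| <= 3 * #|[set u in D | E u v]|].
set G2 := [set v in D | #|F| * (9 * s) < f v * #|D|].
set G := [set v in D | _].
have h1 : #|D| <= 3 * #|G1| + 1 := large_indegree D.
have sumf : \sum_(v in D) f v <= #|F| * s.
  rewrite /f double_count -sum_nat_const; apply: leq_sum => S SF.
  apply: leq_trans (Fs S SF); apply/subset_leq_card/subsetP => v.
  rewrite in_set in_setI => /andP[-> /subsetP h]; rewrite andbT.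
  by apply/common_outP => u /h; rewrite common_in1.
have h2 : 9 * #|G2| <= #|D|.
  have := markov_count D (fun v => f v * #|D|) (#|F| * (9 * s)).
  rewrite -big_distrl /= -/G2.
  (* If [#|F| * s] vanishes it cannot be cancelled from Markov's inequality, but then no set
     survives for any vertex of [D] and [G2] is empty. *)
  case: (posnP (#|F| * s)) => [Fs0 _|Fs0 h]; last first.
    rewrite -(leq_pmul2l Fs0); apply: leq_trans (leq_mul sumf (leqnn #|D|)).
    by apply: leq_trans h; rewrite leq_eqVlt; apply/orP; left; apply/eqP; ring.
  suff -> : #|G2| = 0 by lia.
  apply/eqP; rewrite cards_eq0; apply/eqP/setP => v; rewrite in_set in_set0.
  case vD: (v \in D) => //=.
  have : f v <= 0.
    by rewrite -[X in _ <= X]Fs0; apply: leq_trans sumf; rewrite (bigD1 v) //= leq_addr.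
  by rewrite leqn0 => /eqP ->; rewrite mul0n ltn0.
have h3 : #|G1| <= #|G| + #|G2|.
  apply: leq_trans (leq_card_setU G G2); apply/subset_leq_card/subsetP => v.
  rewrite !in_set => /andP[vD hv]; rewrite vD /=.
  have -> : D :&: common_in [set v] = [set u in D | E u v].
    by apply/setP => u; rewrite in_setI common_in1 in_set.
  by rewrite hv /=; case: leqP.
lia.
Qed.

(* [Om] indexes many candidate sets [D o] at once: by averaging, the vertices of
   [C] can be chosen simultaneously for a large part [Y'] of the indices. *)
Lemma block (Om : finType) (B : {set V}) (s M t : nat) (Y : {set Om})
    (D : Om -> {set V}) (F : Om -> {set {set V}}) :
  0 < #|B| -> 3 <= M ->
  (forall o, o \in Y -> [/\ D o \subset B, M * 3 ^ t <= #|D o|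
     & forall S, S \in F o -> #|common_out E S :&: D o| <= s]) ->
  exists (C : {set V}) (Y' : {set Om}),
    [/\ Y' \subset Y, #|Y| * M ^ t <= #|Y'| * (9 * #|B|) ^ t
     & forall o, o \in Y' -> [/\ C \subset D o, #|D o| <= 3 ^ t * #|D o :&: common_in C|
        & #|[set S in F o | S \subset common_in C]| * M ^ t <= #|F o| * (9 * s) ^ t]].
Proof.
move=> B0 M3; elim: t Y D F => [|t IH] Y D F hY.
  exists set0, Y; split=> //.
  move=> o oY; split; rewrite ?sub0set ?expn0 ?mul1n ?muln1 //.
    by apply/subset_leq_card/subsetP => u uD; rewrite in_setI uD;
      apply/common_inP => v; rewrite inE.
  by apply/subset_leq_card/subsetP => S; rewrite inE => /andP[].
have DM o : o \in Y -> M <= #|D o|.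
  by move=> /hY[_ h _]; apply: leq_trans h; rewrite leq_pmulr ?expn_gt0.
set good := fun o v => [&& v \in D o, #|D o| <= 3 * #|D o :&: common_in [set v]|
   & #|[set S in F o | S \subset common_in [set v]]| * M <= #|F o| * (9 * s)].
have goodY o : o \in Y -> M <= 9 * #|[set v in B | good o v]|.
  move=> oY; have [DB _ Fs] := hY o oY.
  apply: leq_trans (DM o oY) _.
  have D3 : 3 <= #|D o| by apply: leq_trans M3 (DM o oY).
  apply: leq_trans (many_good_vertices D3 Fs) _; rewrite leq_mul2l /=.
  apply/subset_leq_card/subsetP => v; rewrite !in_set => /and3P[vD h1 h2].
  rewrite (subsetP DB) // /good vD h1 /=; apply: leq_trans h2.
  by rewrite leq_mul2l DM ?orbT.
(* Each index has at least [M / 9] good vertices in [B], so some [v] is good for a proportion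
   [M / (9 * #|B|)] of the indices. *)
have [||v vB hv] := @exists_ge_average _ B (fun v => 9 * #|[set o in Y | good o v]|) (#|Y| * M).
- by [].
- rewrite -big_distrr /= -double_count big_distrr -sum_nat_const /=.
  exact: leq_sum.
set Y1 := [set o in Y | good o v] in hv.
set D1 := fun o => D o :&: common_in [set v].
set F1 := fun o => [set S in F o | S \subset common_in [set v]].
have [|C [Y' [Y'Y1 hc hC]]] := IH Y1 D1 F1.
  move=> o; rewrite in_set => /andP[oY /and3P[vD h1 h2]].
  have [DB h3 Fs] := hY o oY; split.
  - by apply: subset_trans DB; apply: subsetIl.
  - rewrite /D1; move: h3; rewrite expnS; lia.
  - move=> S; rewrite in_set => /andP[/Fs h _]; apply: leq_trans h.
    by rewrite subset_leq_card // setIS // subsetIl.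
exists (v |: C), Y'; split.
- by apply: subset_trans Y'Y1 _; apply/subsetP => o; rewrite inE => /andP[].
- rewrite !expnS.
  have h : #|Y1| * M ^ t * (9 * #|B|) <= #|Y'| * (9 * #|B|) ^ t * (9 * #|B|).
    by rewrite leq_mul2r hc orbT.
  have h' : #|Y| * M * M ^ t <= 9 * #|Y1| * #|B| * M ^ t by rewrite leq_mul2r hv orbT.
  move: ((9 * #|B|) ^ t) (M ^ t) h h' => bt Mt; nia.
- move=> o oY'; have [CD1 h1 h2] := hC o oY'.
  have := subsetP Y'Y1 o oY'; rewrite in_set => /andP[oY /and3P[vD h3 h4]].
  have eqF : [set S in F o | S \subset common_in (v |: C)]
      = [set S in F1 o | S \subset common_in C].
    by apply/setP => S; rewrite !in_set common_inU subsetI; case: (S \in F o).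
  split.
  - by rewrite subUset sub1set vD; apply: subset_trans CD1 _; apply: subsetIl.
  - rewrite common_inU setIA -/(D1 o); move: h3 h1; rewrite -/(D1 o) expnS; nia.
  - rewrite eqF !expnS; move: h4 h2; rewrite -/(F1 o).
    move: #|F1 o| #|F o| #|_| (M ^ t) ((9 * s) ^ t) => a b c d e; nia.
Qed.

End VertexChoice.

Lemma exists_subset_card (T : finType) (A : {set T}) n :
  n <= #|A| -> exists2 B : {set T}, B \subset A & #|B| = n.
Proof.
move=> nA; exists [set x in take n (enum A)].
  by apply/subsetP => x; rewrite inE => /mem_take; rewrite mem_enum.
rewrite cardsE (card_uniqP _) ?take_uniq ?enum_uniq // size_take -cardE.
by case: ltngtP nA.
Qed.

(** * Nested sets from successive blocks of choices, and dependent random choice *)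

Section NestedBlocks.
Variables (V : finType) (E : rel V).
Hypothesis tournE : tournament E.

(** These are the exceptional sets of an out-community into [Q] with empty second set. The ground
    set [U] is fixed before the nested sets are chosen inside it. *)
Definition bad_sets (Delta s : nat) (U Q : {set V}) : {set {set V}} :=
  [set S : {set V} | [&& S \subset U, #|S| == Delta & #|common_out E S :&: Q| <= s]].

Lemma card_bad_sets Delta s U Q : #|bad_sets Delta s U Q| <= 'C(#|U|, Delta).
Proof.
rewrite -cards_draws; apply/subset_leq_card/subsetP => S.
by rewrite !inE => /and3P[-> ->].
Qed.

(* The bound on the number of bad sets is the fraction [(9 s / M)^t] of all
   [Delta]-subsets of [U], with denominators cleared. *)
Definition nested_communities Delta s t M w (U W : {set V}) (Bs : nat -> {set V}) : Prop :=
  [/\ forall j, j <= w -> M <= #|Bs j|,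
      forall j, j < w -> Bs j \subset Bs j.+1
    & forall j, j < w ->
        #|[set S in bad_sets Delta s U (Bs j.+1) | S \subset W :|: Bs j]| * M ^ t
          <= 'C(#|U|, Delta) * (9 * s) ^ t].

Lemma nested_communitiesS Delta s t M w (U W W' : {set V}) Bs :
  W' \subset W -> nested_communities Delta s t M w U W Bs ->
  nested_communities Delta s t M w U W' Bs.
Proof.
move=> W'W [h1 h2 h3]; split=> // j jw; apply: leq_trans (h3 j jw).
rewrite leq_mul2r; apply/orP; right; apply/subset_leq_card/subsetP => S.
by rewrite !in_set => /andP[-> /=] /subset_trans; apply; rewrite setSU.
Qed.

(* [C] is made of [w] blocks of [t] vertices. The [j]-th block is chosen inside
   [Bs o j], and [Bs o j.-1] is its common in-neighbourhood there. *)
Lemma nested_blocks (Om : finType) (B U : {set V}) (Delta s M t w : nat) (Y : {set Om})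
    (D : Om -> {set V}) :
  0 < #|B| -> 3 <= M ->
  (forall o, o \in Y -> D o \subset B /\ M * 3 ^ (w * t) <= #|D o|) ->
  exists (C : {set V}) (Y' : {set Om}) (Bs : Om -> nat -> {set V}),
    [/\ Y' \subset Y, #|Y| * M ^ (w * t) <= #|Y'| * (9 * #|B|) ^ (w * t)
     & forall o, o \in Y' ->
        [/\ C \subset D o, Bs o w = D o
          & nested_communities Delta s t M w U (common_in E C) (Bs o)]].
Proof.
move=> B0 M3; elim: w Y D => [|w IH] Y D hY.
  exists set0, Y, (fun o _ => D o); split=> // o /hY [_ h].
  split; rewrite ?sub0set //; split=> // j _.
  by apply: leq_trans h; rewrite muln1.
(* The first block chosen is the top one; it shrinks [D o] to [D1 o], to which the induction
   hypothesis applies. *)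
have [|C0 [Y0 [Y0Y hc0 hY0]]] := @block _ E tournE _ B s M t Y D
   (fun o => bad_sets Delta s U (D o)) B0 M3.
  move=> o oY; have [DB h] := hY o oY; split=> //.
    apply: leq_trans h; rewrite leq_mul2l leq_exp2l //; lia.
  by move=> S; rewrite inE => /and3P[].
set D1 := fun o => D o :&: common_in E C0.
have D1D o : D1 o \subset D o by apply: subsetIl.
have [|C1 [Y1 [Bs1 [Y1Y0 hc1 hY1]]]] := IH Y0 D1.
  move=> o oY0; have oY := subsetP Y0Y o oY0.
  have [DB h] := hY o oY; have [_ h1 _] := hY0 o oY0.
  split; first exact: subset_trans (D1D o) DB.
  have t0 : 0 < 3 ^ t by rewrite expn_gt0.
  rewrite -(leq_pmul2l t0); apply: leq_trans h1; apply: leq_trans h.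
  by rewrite mulSn expnD mulnCA.
exists (C0 :|: C1), Y1, (fun o j => if j == w.+1 then D o else Bs1 o j); split.
- exact: subset_trans Y1Y0 Y0Y.
- rewrite mulSn !expnD mulnA.
  apply: leq_trans (leq_mul hc0 (leqnn _)) _.
  by rewrite mulnAC [_ ^ t * _]mulnC mulnA leq_mul2r hc1 orbT.
- move=> o oY1; have oY0 := subsetP Y1Y0 o oY1; have oY := subsetP Y0Y o oY0.
  have [C0D _ hb] := hY0 o oY0; have [C1D1 Bsw [hM hsub hbad]] := hY1 o oY1.
  have [DB hD] := hY o oY.
  split; rewrite ?eqxx //.
    by rewrite subUset C0D; apply: subset_trans C1D1 (D1D o).
  split=> j; rewrite ?ltnS => jw.
  + case: eqP => [_|/eqP jw']; first by apply: leq_trans hD; rewrite leq_pmulr ?expn_gt0.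
    apply: hM; lia.
  + have [|_] := eqVneq j w.+1; first by lia.
    rewrite eqSS; have [->|jw'] := eqVneq j w; first by rewrite Bsw.
    apply: hsub; lia.
  + have [|_] := eqVneq j w.+1; first by lia.
    rewrite eqSS; have [->|jw'] := eqVneq j w.
      (* Here [Bs1 o w = D1 o], so the sets to be counted lie in the common in-neighbourhood of [C0]
         and the bound from the first block applies. *)
      apply: leq_trans (_ : _ <= #|bad_sets Delta s U (D o)| * (9 * s) ^ t) _; last first.
        by rewrite leq_mul2r card_bad_sets orbT.
      apply: leq_trans hb; rewrite leq_mul2r; apply/orP; right.
      apply/subset_leq_card/subsetP => S; rewrite !in_set => /andP[-> /=].
      move/subset_trans; apply; rewrite common_inU Bsw subUset subsetIl /=.
      exact: subsetIr.
    apply: leq_trans (hbad j _); last by lia.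
    rewrite leq_mul2r; apply/orP; right.
    apply/subset_leq_card/subsetP => S; rewrite !in_set => /andP[-> /=].
    by move/subset_trans; apply; rewrite common_inU setSU // subsetIr.
Qed.

(** Count pairs of a tuple and a vertex of [B] in its common out-neighbourhood. Each vertex occurs
    with at least [(#|X| / 3) ^ r] tuples, so the average common out-neighbourhood has size at least
    [#|B| / 3 ^ r], that is, at least [2 * n0]. Tuples below [n0] account for at most half of the
    pairs. *)
Lemma dependent_random_choice (X B : {set V}) (r n0 : nat) :
  (forall v, v \in B -> #|X| <= 3 * #|[set u in X | E u v]|) ->
  0 < n0 -> 2 * 3 ^ r * n0 <= #|B| ->
  #|X| ^ r <= 2 * 3 ^ r * #|[set o in ffun_on (mem X) : pred {ffun 'I_r -> V} |
      n0 <= #|[set v in B | [forall k, E (o k) v]]|]|.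
Proof.
move=> hX n0_gt0 hB.
set A : {set {ffun 'I_r -> V}} := [set o in ffun_on (mem X)].
have cA : #|A| = #|X| ^ r by rewrite cardsE card_ffun_on card_ord.
set f := fun o : {ffun 'I_r -> V} => #|[set v in B | [forall k, E (o k) v]]|.
set Y := [set o in _ | _].
have eY : Y = [set o in A | n0 <= f o] by apply/setP => o; rewrite !in_set.
have lo : #|B| * #|X| ^ r <= 3 ^ r * \sum_(o in A) f o.
  rewrite /f double_count big_distrr -sum_nat_const /=; apply: leq_sum => v vB.
  have -> : [set o in A | [forall k, E (o k) v]]
     = [set o : {ffun 'I_r -> V} in ffun_on (mem [set u in X | E u v])].
    apply/setP => o; rewrite !in_set; apply/andP/ffun_onP => [[/ffun_onP h1 /forallP h2] k|h].
      by rewrite in_set h1 h2.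
    split; first by apply/ffun_onP => k; have := h k; rewrite in_set => /andP[].
    by apply/forallP => k; have := h k; rewrite in_set => /andP[].
  rewrite cardsE card_ffun_on card_ord -expnMn; case: (posnP r) => [->//|r0].
  by rewrite leq_exp2r // hX.
have hi : \sum_(o in A) f o <= #|Y| * #|B| + #|X| ^ r * n0.
  rewrite -cA eY card_set_sum big_distrl -sum_nat_const -big_split /=.
  apply: leq_sum => o _; case: (leqP n0 (f o)) => [_|/ltnW fn]; last by rewrite /= mul0n.
  rewrite /= mul1n; apply: leq_trans (leq_addr _ _).
  by apply/subset_leq_card/subsetP => v; rewrite in_set => /andP[].
have B0 : 0 < #|B| by apply: leq_trans hB; rewrite !muln_gt0 n0_gt0 expn_gt0.
rewrite -(leq_pmul2l B0).
move: lo hi hB; move: (\sum_(o in A) f o) (#|X| ^ r) (3 ^ r) #|B| #|Y| => S x c b y h1 h2 h3.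
have h4 := leq_mul (leqnn c) h2; have h5 := leq_mul h3 (leqnn x).
nia.
Qed.

End NestedBlocks.

(** * A single level *)

Section OneLevel.
Variables (V : finType) (E : rel V).
Hypothesis tournE : tournament E.

(* The index set is the set of [r]-tuples [o] of vertices of [X], with [D o]
   inside the common out-neighbourhood of [o] in [B], and [C] has [L = r / 2]
   vertices. A tuple surviving the choice of [C] has all its entries in
   [X :&: common_in C], so that the number of surviving tuples bounds the size
   of this set from below. *)
Lemma nested_level (X B U : {set V}) (Delta s M M' w q : nat) :
  q = 3 ^ (Delta * w) ->
  0 < Delta -> 0 < w -> 3 <= M -> 0 < M' ->
  (forall v, v \in B -> #|X| <= 3 * #|[set u in X | E u v]|) ->
  #|B| = 2 * q ^ 6 * M -> #|X| = 60 * q ^ 9 * M' ->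
  exists (W : {set V}) (Bs : nat -> {set V}),
    [/\ W \subset X, #|W| = 2 * q ^ 6 * M', Bs w \subset B, #|Bs w| = q ^ 2 * M
      & nested_communities E Delta s (2 * Delta) M w U W Bs].
Proof.
move=> qE Delta0 w0 M3 M'0 hX cB cX.
set L := w * (2 * Delta); set r := 2 * L.
have q0 : 0 < q by rewrite qE expn_gt0.
(* The candidate sets may shrink by [3 ^ L] under the [L] choices, and passing to common
   out-neighbourhoods of tuples loses [2 * 3 ^ r]. This explains the sizes [q ^ 2 * M] of [D o] and
   [2 * q ^ 6 * M] of [B]. *)
have qL : 3 ^ L = q ^ 2 by rewrite qE -expnM; congr (_ ^ _); rewrite /L; lia.
have qr : 3 ^ r = q ^ 4 by rewrite /r mulnC expnM qL -expnM.
have M0 : 0 < M by lia.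
have n0_gt0 : 0 < q ^ 2 * M by rewrite muln_gt0 ?expn_gt0 ?q0.
have B0 : 0 < #|B| by rewrite cB !muln_gt0 ?expn_gt0 ?q0.
have := @dependent_random_choice _ E X B r _ hX n0_gt0.
rewrite cB qr (_ : 2 * q ^ 4 * (q ^ 2 * M) = 2 * q ^ 6 * M); last by ring.
move=> /(_ (leqnn _)); set Y := [set o in _ | _] => hY.
have /fin_all_exists [D hD] : forall o : {ffun 'I_r -> V}, exists D : {set V}, o \in Y ->
    D \subset [set v in B | [forall k, E (o k) v]] /\ #|D| = q ^ 2 * M.
  move=> o; case oY: (o \in Y); last by exists set0.
  move: oY; rewrite in_set => /andP[_ /exists_subset_card [D h1 h2]].
  by exists D.
have [|C [Y' [Bs [Y'Y hc hBs]]]] :=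
    @nested_blocks _ E tournE _ B U Delta s M (2 * Delta) w Y D B0 M3.
  move=> o oY; have [h1 h2] := hD o oY; split.
    by apply: subset_trans h1 _; apply/subsetP => v; rewrite in_set => /andP[].
  by rewrite h2 -qL mulnC.
rewrite -/L in hc.
set W := X :&: common_in E C.
have Y'W : #|Y'| <= #|W| ^ r.
  rewrite -[r in X in _ <= X]card_ord -card_ffun_on.
  apply/subset_leq_card/subsetP => o oY'; have oY := subsetP Y'Y o oY'.
  have [CD _ _] := hBs o oY'; have [DB _] := hD o oY.
  move: oY; rewrite !in_set => /andP[/ffun_onP oX _]; apply/ffun_onP => k.
  rewrite in_setI oX; apply/common_inP => v vC.
  have := subsetP (subset_trans CD DB) v vC.
  by rewrite in_set => /andP[_ /forallP].
have r0 : 0 < r by rewrite !muln_gt0 w0 Delta0.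
(* Each choice costs a factor [9 * #|B| / M = 18 * q ^ 6], less than [(5 * q ^ 3) ^ 2]. As
   [r = 2 * L], this amounts to [5 * q ^ 3] per tuple entry, and the factor [2 * q ^ 4] of the
   random choice to at most 6 more. Taking [r]-th roots then loses only [30 * q ^ 3] from [#|X|] to
   [#|W|]. *)
have xY' : #|X| ^ r * M ^ L <= #|Y'| * (30 * q ^ 3) ^ r * M ^ L.
  have h1 : (9 * #|B|) ^ L <= (5 * q ^ 3) ^ r * M ^ L.
    rewrite /r (expnM _ 2) -expnMn; case: (posnP L) => [->//|L0].
    rewrite leq_exp2r // cB.
    rewrite (_ : (5 * q ^ 3) ^ 2 * M = 25 * q ^ 6 * M); last by ring.
    rewrite (_ : 9 * (2 * q ^ 6 * M) = 18 * q ^ 6 * M); last by ring.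
    by rewrite leq_mul2r leq_mul2r orbT orbT.
  have h2 : 2 * q ^ 4 <= 6 ^ r.
    rewrite -qr -[6]/(2 * 3) expnMn leq_mul2r; apply/orP; right.
    by rewrite -[X in X <= _](expn1 2) leq_exp2l.
  apply: leq_trans (leq_mul hY (leqnn _)) _; rewrite -mulnA.
  apply: leq_trans (leq_mul h2 (leq_trans hc (leq_mul (leqnn _) h1))) _.
  rewrite (_ : 30 * q ^ 3 = 6 * (5 * q ^ 3)); last by ring.
  by rewrite [in X in _ <= X]expnMn leq_eqVlt; apply/orP; left; apply/eqP; ring.
have {}xY' : #|X| ^ r <= #|Y'| * (30 * q ^ 3) ^ r.
  by move: xY'; rewrite leq_pmul2r // expn_gt0 M0.
have cW : 2 * q ^ 6 * M' <= #|W|.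
  have : #|X| ^ r <= (#|W| * (30 * q ^ 3)) ^ r.
    by apply: leq_trans xY' _; rewrite [(#|W| * _) ^ _]expnMn leq_mul2r Y'W orbT.
  rewrite leq_exp2r // cX (_ : 60 * q ^ 9 * M' = 2 * q ^ 6 * M' * (30 * q ^ 3)); last by ring.
  by rewrite leq_pmul2r // muln_gt0 ?expn_gt0 ?q0.
have /card_gt0P [o oY'] : 0 < #|Y'|.
  have : 0 < #|X| ^ r by rewrite expn_gt0 cX !muln_gt0 ?expn_gt0 ?q0 M'0.
  by move=> /leq_trans /(_ xY'); rewrite muln_gt0 => /andP[].
have [_ Bsw hnest] := hBs o oY'.
have [DB cD] := hD o (subsetP Y'Y o oY').
have [W' W'W cW'] := exists_subset_card cW.
exists W', (Bs o); split=> //.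
- exact: subset_trans W'W (subsetIl _ _).
- rewrite Bsw; apply: subset_trans DB _.
  by apply/subsetP => v; rewrite in_set => /andP[].
- by rewrite Bsw.
- apply: nested_communitiesS hnest; apply: subset_trans W'W _; exact: subsetIr.
Qed.

(** At the lowest level there is no earlier set to keep large, so one candidate set, indexed by
    [unit], suffices. *)
Lemma nested_first_level (B U : {set V}) (Delta s M w q : nat) :
  q = 3 ^ (Delta * w) ->
  3 <= M -> #|B| = 2 * q ^ 6 * M ->
  exists Bs : nat -> {set V},
    [/\ Bs w \subset B, #|Bs w| = q ^ 2 * M
      & nested_communities E Delta s (2 * Delta) M w U set0 Bs].
Proof.
move=> qE M3 cB.
have q0 : 0 < q by rewrite qE expn_gt0.
have [|D DB cD] := @exists_subset_card _ B (q ^ 2 * M).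
  rewrite cB leq_mul2r; apply/orP; right.
  by apply: leq_trans (leq_pmull _ _) => //; rewrite leq_pexp2l.
have [|||C [Y' [Bs [_ hc hBs]]]] := @nested_blocks _ E tournE unit B U Delta s M (2 * Delta) w
   [set: unit] (fun=> D).
- by rewrite cB !muln_gt0 ?expn_gt0 ?q0; lia.
- by [].
- move=> _ _; split=> //; rewrite cD mulnC leq_mul2r qE -expnM.
  by apply/orP; right; rewrite leq_exp2l //; lia.
have /card_gt0P [o oY'] : 0 < #|Y'|.
  move: hc; rewrite cardsT card_unit mul1n; case: posnP => // ->.
  by rewrite mul0n leqn0 expn_eq0 => /andP[/eqP M0]; move: M3; rewrite M0.
have [_ Bsw hnest] := hBs o oY'.
exists (Bs o); split; rewrite ?Bsw //.
exact: nested_communitiesS (sub0set _) hnest.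
Qed.

End OneLevel.

(** * Median orders *)

Lemma exists_max_seq (T : eqType) (f : T -> nat) (l : seq T) x0 :
  x0 \in l -> exists2 x, x \in l & forall y, y \in l -> f y <= f x.
Proof.
elim: l x0 => // a [|b l] IH x0 _.
  by exists a; rewrite ?mem_head // => y; rewrite inE => /eqP ->.
have [x xl hx] := IH b (mem_head _ _).
have [fa|fa] := leqP (f a) (f x).
  exists x; first by rewrite in_cons xl orbT.
  by move=> y; rewrite in_cons => /predU1P[->|/hx].
exists a; first exact: mem_head.
move=> y; rewrite in_cons => /predU1P[-> //|/hx h]; exact: leq_trans h (ltnW fa).
Qed.

Lemma count_windows (T : Type) (a : pred T) (n k : nat) (s : seq T) :
  count a (take (n * k) s) = \sum_(j < k) count a (take n (drop (n * j) s)).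
Proof.
elim: k => [|k IH]; first by rewrite muln0 take0 big_ord0.
by rewrite big_ord_recr /= -IH mulnSr takeD count_cat.
Qed.

Section MedianOrder.
Variables (V : finType) (E : rel V).
Hypothesis tournE : tournament E.

Fixpoint forward_edges (s : seq V) : nat :=
  if s is x :: s' then count (E x) s' + forward_edges s' else 0.

Lemma forward_edges_cat s1 s2 :
  forward_edges (s1 ++ s2)
    = forward_edges s1 + \sum_(x <- s1) count (E x) s2 + forward_edges s2.
Proof.
elim: s1 => [|x s1 IH] /=; first by rewrite big_nil.
by rewrite IH big_cons count_cat; ring.
Qed.

Definition median_order (s : seq V) : Prop :=
  perm_eq s (enum V) /\
  forall s', perm_eq s' (enum V) -> forward_edges s' <= forward_edges s.

Lemma median_order_exists : exists s, median_order s.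
Proof.
have [|s] := @exists_max_seq _ forward_edges (permutations (enum V)) (enum V).
  by rewrite mem_permutations.
rewrite mem_permutations => hs hmax; exists s; split=> // s' hs'.
by apply: hmax; rewrite mem_permutations.
Qed.

(* Otherwise moving [u] behind [s2] would create more forward edges. *)
Lemma median_order_out s s1 u s2 s3 :
  median_order s -> s = s1 ++ (u :: s2) ++ s3 -> size s2 <= (count (E u) s2).*2.
Proof.
move=> [hs hmax] es.
have p : perm_eq (u :: s2) (s2 ++ [:: u]) by rewrite cats1 perm_sym perm_rcons.
have us2 : u \notin s2.
  have : uniq s by rewrite (perm_uniq hs) enum_uniq.
  by rewrite es !cat_uniq => /and3P[_ _ /and3P[/andP[]]].
have : forward_edges (s1 ++ (s2 ++ [:: u]) ++ s3) <= forward_edges s.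
  by apply: hmax; apply: perm_trans hs; rewrite es perm_cat2l perm_cat2r perm_sym.
rewrite es !forward_edges_cat.
rewrite (perm_big _ p).
have -> : \sum_(x <- s1) count (E x) ((s2 ++ [:: u]) ++ s3)
  = \sum_(x <- s1) count (E x) ((u :: s2) ++ s3).
  by apply: eq_bigr => x _; apply/permP; rewrite perm_cat2r perm_sym.
have -> : \sum_(x <- s2) count (E x) [:: u] = count (E^~ u) s2.
  by rewrite -sum1_count [RHS]big_mkcond /=; apply: eq_bigr => x _; rewrite addn0; case: (E x u).
have : count (E u) s2 + count (E^~ u) s2 = size s2.
  rewrite -(count_predC (E u) s2); congr (_ + _); apply: eq_in_count => v vs2 /=.
  have uv : u != v by apply: contraNneq us2 => ->.
  by move: (tournE.2 _ _ uv); case: (E u v); case: (E v u).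
move: (\sum_(x <- s1) _) (\sum_(x <- _ ++ _) _) => S1 S2; rewrite /=; lia.
Qed.

Lemma count_set (a : pred V) (P : seq V) : uniq P -> count a P = #|[set v in P | a v]|.
Proof.
move=> uP; rewrite -size_filter -(card_uniqP (filter_uniq a uP)).
by apply: eq_card => v; rewrite in_set mem_filter andbC.
Qed.

(* [X] is spread over the short window [W] while the next [96 x] vertices [P]
   form a long interval, so about half of the pairs of [X * P] are forward
   edges. At least [12 x] vertices of [P] then have in-degree [#|X| / 3] in [X],
   and one of the 12 windows of [P] contains [x] of them. *)
Lemma next_window s s1 W s2 (X : {set V}) (x : nat) :
  median_order s -> s = s1 ++ W ++ s2 -> {subset X <= W} ->
  0 < x -> 96 * x <= size s2 -> size W <= 16 * x ->
  exists (s' W' s2' : seq V) (X' : {set V}),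
    [/\ s2 = s' ++ W' ++ s2', {subset X' <= W'}, #|X'| = x,
        size W' = 8 * x /\ size s2 <= size s2' + 96 * x
      & forall v, v \in X' -> #|X| <= 3 * #|[set u in X | E u v]|].
Proof.
move=> med es XW x0 hs2 hW.
set P := take (96 * x) s2.
have sP : size P = 96 * x by rewrite size_takel.
have uP : uniq P.
  have : uniq s by rewrite (perm_uniq med.1) enum_uniq.
  by rewrite es !cat_uniq => /and3P[_ _ /and3P[_ _]]; apply: take_uniq.
(* With [Wb] the part of [W] after [u], half of [Wb ++ P] are out-neighbours of [u], and at most
   [size Wb] of them lie in [Wb]. This leaves [48 * x - size Wb / 2] in [P], where
   [size Wb <= 16 * x]. *)
have degX u : u \in X -> 40 * x <= #|[set v in P | E u v]|.
  move=> /XW uW; rewrite -count_set //.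
  have [Wa [Wb eW]] : exists Wa Wb, W = Wa ++ u :: Wb by case/splitPr: uW => Wa Wb; exists Wa, Wb.
  have := @median_order_out s (s1 ++ Wa) u (Wb ++ P) (drop (96 * x) s2) med.
  rewrite es eW -!catA /= -catA cat_take_drop => /(_ erefl).
  rewrite count_cat size_cat sP; move: hW; rewrite eW size_cat /=.
  have := count_size (E u) Wb; lia.
set G := [set v in P | #|X| <= 3 * #|[set u in X | E u v]|].
(* Vertices of [P] outside [G] receive fewer than [#|X| / 3] edges from [X], the others at most
   [#|X|]. Hence [3 * 40 * x <= 96 * x + 2 * #|G|]. *)
have cG : 0 < #|X| -> 12 * x <= #|G|.
  move=> X0.
  have cP : #|[set v in P]| = 96 * x by rewrite cardsE (card_uniqP uP).
  have h1 : #|X| * (40 * x) <= \sum_(v in [set v in P]) #|[set u in X | E u v]|.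
    rewrite -double_count -sum_nat_const; apply: leq_sum => u uX.
    apply: leq_trans (degX u uX) _; apply/subset_leq_card/subsetP => v.
    by rewrite !in_set.
  have h2 : \sum_(v in [set v in P]) 3 * #|[set u in X | E u v]|
     <= #|X| * (96 * x) + #|G| * (2 * #|X|).
    have -> : G = [set v in [set v in P] | #|X| <= 3 * #|[set u in X | E u v]|].
      by apply/setP => v; rewrite !in_set.
    rewrite card_set_sum big_distrl -cP mulnC -sum_nat_const -big_split /=.
    apply: leq_sum => v _; case: (leqP #|X| (3 * _)) => /= [_|/ltnW]; last by rewrite mul0n addn0.
    have : #|[set u in X | E u v]| <= #|X|.
      by apply/subset_leq_card/subsetP => u; rewrite in_set => /andP[].
    lia.
  rewrite -big_distrr /= in h2.
  rewrite -(leq_pmul2l X0); move: h1 h2; move: (\sum_(v in _) _) => S h1 h2; nia.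
(* For empty [X] the degree condition is vacuous and the first window serves. *)
have [->|X0] := posnP #|X|.
  exists [::], (take (8 * x) s2), (drop (8 * x) s2).
  have u8 : uniq (take (8 * x) s2).
    have -> : take (8 * x) s2 = take (8 * x) P by rewrite take_takel // leq_mul2r orbT.
    exact: take_uniq.
  have s8 : size (take (8 * x) s2) = 8 * x by rewrite size_takel //; lia.
  have [|X' X'W cX'] := @exists_subset_card _ [set v in take (8 * x) s2] x.
    rewrite cardsE (card_uniqP u8) s8; lia.
  exists X'; split=> //; first by rewrite cat_take_drop.
    by move=> v /(subsetP X'W); rewrite in_set.
  by split=> //; rewrite size_drop; lia.
have {}cG := cG X0.
have cGP : count (mem G) (take (8 * x * 12) s2) = #|G|.
  rewrite (_ : 8 * x * 12 = 96 * x) -/P; last by lia.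
  rewrite count_set //; apply: eq_card => v; rewrite [RHS]in_set !inE. by case: (v \in P).
have [j hj] : exists j : 'I_12, x <= count (mem G) (take (8 * x) (drop (8 * x * j) s2)).
  apply/existsP; apply: contraLR cG => /existsPn h; rewrite -ltnNge -cGP count_windows.
  apply: leq_ltn_trans (_ : \sum_(j < 12) x.-1 < _).
    by apply: leq_sum => j _; have := h j; lia.
  rewrite sum_nat_const card_ord; lia.
have := ltn_ord j; move: (nat_of_ord j) hj => {}j hj j12.
set W' := take (8 * x) (drop (8 * x * j) s2).
have uW' : uniq W'.
  have : uniq s by rewrite (perm_uniq med.1) enum_uniq.
  rewrite es !cat_uniq => /and3P[_ _ /and3P[_ _ us2]].
  by apply: take_uniq; apply: drop_uniq.
have [|X' X'G cX'] := @exists_subset_card _ [set v in W' | v \in G] x.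
  by rewrite -count_set.
exists (take (8 * x * j) s2), W', (drop (8 * x) (drop (8 * x * j) s2)), X'; split=> //.
- by rewrite !cat_take_drop.
- by move=> v /(subsetP X'G); rewrite in_set => /andP[].
- have h : 8 * x * j.+1 <= size s2 by apply: leq_trans hs2; nia.
  rewrite !size_drop; split; last by nia.
  rewrite size_takel // size_drop; nia.
- by move=> v /(subsetP X'G); rewrite in_set => /andP[_]; rewrite in_set => /andP[].
Qed.

(** Iterates [next_window] along a median order. The window of level [i] has length at most
    [8 * x i], hence at most [16 * x i.+1], and each level uses up at most [96 * x i] vertices of
    the order. Disjointness comes from the windows, which follow one another. *)
Lemma dense_chain (h : nat) (x : nat -> nat) :
  (forall i, 1 <= i <= h -> 0 < x i) ->
  (forall i, 1 <= i < h -> x i <= 2 * x i.+1) ->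
  \sum_(1 <= i < h.+1) 96 * x i <= #|V| ->
  exists X : nat -> {set V},
    [/\ forall i, 1 <= i <= h -> #|X i| = x i,
        forall i k, 1 <= i -> i < k -> k <= h -> [disjoint X i & X k]
      & forall i v, 1 <= i < h -> v \in X i.+1 -> #|X i| <= 3 * #|[set u in X i | E u v]|].
Proof.
move=> x0 x2 hV.
have [s med] := median_order_exists.
have us : uniq s by rewrite (perm_uniq med.1) enum_uniq.
have ss : size s = #|V| by rewrite (perm_size med.1) -cardE.
have key n : 1 <= n <= h -> exists (X : nat -> {set V}) s1 W s2,
   [/\ s = s1 ++ W ++ s2, {subset X n <= W} /\ size W <= 8 * x n,
     forall i, 1 <= i <= n -> #|X i| = x i /\ {subset X i <= s1 ++ W},
     forall i k, 1 <= i -> i < k -> k <= n -> [disjoint X i & X k]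
    & (forall i v, 1 <= i < n -> v \in X i.+1 -> #|X i| <= 3 * #|[set u in X i | E u v]|)
    /\ \sum_(n.+1 <= i < h.+1) 96 * x i <= size s2].
  elim: n => // n IH nh.
  have [n0|n0] := posnP n.
    move: nh; rewrite {}n0 => h0 {IH}.
    move: hV; rewrite big_ltn // => hV.
    have s8 : size (take (8 * x 1) s) = 8 * x 1 by rewrite size_takel // ss; lia.
    have [|X XW cX] := @exists_subset_card _ [set v in take (8 * x 1) s] (x 1).
      by rewrite cardsE (card_uniqP (take_uniq _ us)) s8; lia.
    have XW' : {subset X <= take (8 * x 1) s} by move=> v /(subsetP XW); rewrite in_set.
    exists (fun=> X), [::], (take (8 * x 1) s), (drop (8 * x 1) s); split.
    - by rewrite cat_take_drop.
    - by rewrite s8.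
    - by move=> i i1; have -> : i = 1 by lia.
    - by move=> i k; lia.
    - split; first by move=> i v; lia.
      by rewrite size_drop ss; lia.
  have [|X [s1 [W [s2 [es [XW sW] hX dX [gX hs2]]]]]] := IH; first by lia.
  move: hs2; rewrite big_ltn; last by lia.
  move=> hs2.
  have x0n : 0 < x n.+1 by apply: x0.
  have x2n : x n <= 2 * x n.+1 by apply: x2; lia.
  have [||s' [W' [s2' [X' [es2 X'W' cX' [sW' ss2'] gX']]]]] :=
    @next_window s s1 W s2 (X n) (x n.+1) med es XW x0n.
  - by apply: leq_trans hs2; apply: leq_addr.
  - by lia.
  exists (fun i => if i == n.+1 then X' else X i), (s1 ++ W ++ s'), W', s2'; split.
  - by rewrite es es2 -!catA.
  - by rewrite eqxx sW'.
  - move=> i hi; case: eqP => [->|ni].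
      by split=> // v /X'W'; rewrite mem_cat orbC => ->.
    have [|-> hXi] := hX i; first by lia.
    by split=> // v /hXi; rewrite !mem_cat => /orP[] ->; rewrite ?orbT.
  - move=> i k i1 ik kn; case: eqP => [ei|ni]; first by lia.
    case: eqP => [ek|nk]; last by apply: dX; lia.
    have [|_ hXi] := hX i; first by lia.
    rewrite disjoint_subset; apply/subsetP => v /hXi vs1; rewrite inE.
    apply/negP => /X'W' vW'; move: us; rewrite es es2 !catA cat_uniq => /and3P[us1 _ _].
    move: us1; rewrite -catA cat_uniq => /and3P[_ /hasPn /(_ v)].
    by rewrite mem_cat vW' orbT => /(_ isT); rewrite /= vs1.
  - split.
      move=> i v hi; rewrite eqSS; have [ei|_] := eqVneq i n.+1; first by lia.
      have [->|ni] := eqVneq i n; first exact: gX'.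
      by apply: gX; lia.
    by lia.
have [h0|h0] := posnP h.
  exists (fun=> set0); rewrite h0; split.
  - by move=> i; lia.
  - by move=> i k; lia.
  - by move=> i v; rewrite ltn0 andbF.
have [|X [s1 [W [s2 [_ _ h3 h4 [h5 _]]]]]] := key h; first by rewrite h0 /=.
by exists X; split=> // i /h3 [].
Qed.
End MedianOrder.

(** * All levels *)

(** The falling factorials are compared factor by factor: [n - i <= n] and [p <= k - i] for
    [i < d]. *)
Lemma bin_ratio (n k p d : nat) : p + d <= k -> 'C(n, d) * p ^ d <= 'C(k, d) * n ^ d.
Proof.
move=> pdk; rewrite -(leq_pmul2r (fact_gt0 d)).
rewrite mulnAC bin_ffact [_ * _ * _`!]mulnAC bin_ffact mulnC.
apply: leq_mul.
  rewrite ffact_prod -[d in _ ^ d]card_ord -prod_nat_const; apply: leq_prod => i _.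
  by have := ltn_ord i; lia.
by rewrite ffact_prod -[d in _ ^ d]card_ord -prod_nat_const; apply: leq_prod => i _;
  apply: leq_subr.
Qed.

Section Levels.
Variables (V : finType) (E : rel V).
Hypothesis tournE : tournament E.

Lemma community_levels (Delta w h q : nat) (s M : nat -> nat) :
  q = 3 ^ (Delta * w) -> 0 < Delta -> 0 < w ->
  (forall i, 1 <= i <= h -> 3 <= M i) ->
  (forall i, 1 <= i < h -> M i <= 2 * M i.+1) ->
  \sum_(1 <= i < h.+1) 96 * (60 * q ^ 9 * M i) <= #|V| ->
  exists (B : nat -> {set V}) (Bs : nat -> nat -> {set V}),
    [/\ B 0 = set0,
        forall i k, 1 <= i -> i < k -> k <= h -> [disjoint B i & B k],
        forall i, 1 <= i <= h -> Bs i w \subset B i /\ #|Bs i w| = q ^ 2 * M i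
      & forall i, 1 <= i <= h -> exists U : {set V},
          [/\ B i.-1 \subset U, B i \subset U, #|U| <= 121 * q ^ 9 * M i
            & nested_communities E Delta (s i) (2 * Delta) (M i) w U (B i.-1) (Bs i)]].
Proof.
move=> qE Delta0 w0 M3 M2 hV.
have q3 : 3 <= q by rewrite qE -[X in X <= _](expn1 3) leq_exp2l // muln_gt0 Delta0.
have [X [cX dX gX]] : exists X : nat -> {set V},
    [/\ forall i, 1 <= i <= h -> #|X i| = 60 * q ^ 9 * M i,
        forall i k, 1 <= i -> i < k -> k <= h -> [disjoint X i & X k]
      & forall i v, 1 <= i < h -> v \in X i.+1 -> #|X i| <= 3 * #|[set u in X i | E u v]|].
  apply: (dense_chain tournE) hV => i hi.
    have q9 : 0 < q ^ 9 by rewrite expn_gt0; lia.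
    by have := M3 i hi; move: (q ^ 9) q9 => Q; nia.
  by rewrite mulnCA leq_mul2l M2 ?orbT.
have [h0|h0] := posnP h.
  by exists (fun=> set0), (fun _ _ => set0); rewrite h0; split=> // i; lia.
have cU i : 2 * q ^ 6 * M i <= q ^ 9 * M i.
  rewrite leq_mul2r (_ : 9 = 3 + 6) // expnD leq_mul2r; apply/orP; right.
  by apply/orP; right; apply: leq_trans (_ : 3 ^ 3 <= _); rewrite ?leq_exp2r.
(* Downward induction: the lowest [B i] reached has its size and place in [X i], but no nested sets
   yet. The next step finds these together with [B i.-1]. The ground set is [X i.-1 :|: B i], of
   size at most [60 * q ^ 9 * M i.-1 + q ^ 9 * M i], whence the constant 121. *)
have key d : d < h -> exists (B : nat -> {set V}) (Bs : nat -> nat -> {set V}),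
    [/\ forall i, h - d <= i <= h -> B i \subset X i /\ #|B i| = 2 * q ^ 6 * M i,
        forall i, h - d < i <= h -> Bs i w \subset B i /\ #|Bs i w| = q ^ 2 * M i
      & forall i, h - d < i <= h -> exists U : {set V},
          [/\ B i.-1 \subset U, B i \subset U, #|U| <= 121 * q ^ 9 * M i
            & nested_communities E Delta (s i) (2 * Delta) (M i) w U (B i.-1) (Bs i)]].
  elim: d => [|d IH] dh.
    have [|B BX cB] := @exists_subset_card _ (X h) (2 * q ^ 6 * M h).
      have hh : 1 <= h <= h by lia.
      rewrite cX //; apply: leq_trans (cU h) _; lia.
    exists (fun=> B), (fun _ _ => set0); split=> i hi; try lia.
    by have -> : i = h by lia.
  have [|B [Bs [hB hBs hU]]] := IH; first by lia.
  set n := h - d in hB hBs hU.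
  have -> : h - d.+1 = n.-1 by lia.
  have n2 : 1 < n <= h by rewrite /n; lia.
  have [BX cB] : B n \subset X n /\ #|B n| = 2 * q ^ 6 * M n by apply: hB; lia.
  have Mn : M n.-1 <= 2 * M n by have := M2 n.-1; rewrite prednK; [apply; lia|lia].
  have cX' : #|X n.-1| = 60 * q ^ 9 * M n.-1 by apply: cX; lia.
  have [|||W [Bsn [WX cW BsB cBs hn]]] :=
    @nested_level _ E tournE (X n.-1) (B n) (X n.-1 :|: B n) Delta (s n) (M n) (M n.-1) w q
      qE Delta0 w0 _ _ _ cB cX'.
  - by apply: M3; lia.
  - by apply: leq_trans (M3 _ _) => //; lia.
  - by move=> v /(subsetP BX) vX; apply: gX; rewrite ?prednK //; lia.
  exists (fun i => if i == n.-1 then W else B i), (fun i => if i == n then Bsn else Bs i).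
  split=> i hi.
  - case: eqP => [->|ni]; first by [].
    by apply: hB; lia.
  - rewrite [if i == n.-1 then _ else _]ifN; last by lia.
    case: eqP => [->|ni]; first by [].
    by apply: hBs; lia.
  - rewrite [if i == n.-1 then _ else _]ifN; last by lia.
    have [->|ni] := eqVneq i n; last first.
      rewrite [if i.-1 == n.-1 then _ else _]ifN; last by lia.
      by apply: hU; lia.
    rewrite eqxx; exists (X n.-1 :|: B n); split=> //.
    + by apply: subset_trans WX (subsetUl _ _).
    + exact: subsetUr.
    + apply: leq_trans (leq_card_setU _ _) _; rewrite cX' cB.
      have := cU n; move: (q ^ 9) (q ^ 6) Mn => a b; nia.
have [|B [Bs [hB hBs hU]]] := key h.-1; first by lia.
have e1 : h - h.-1 = 1 by lia.
rewrite e1 in hB hBs hU.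
have h1 : 1 <= 1 <= h by [].
have [BX1 cB1] := hB 1 h1.
have [Bs1 [Bs1B cBs1 hn1]] := @nested_first_level _ E tournE (B 1) (B 1) Delta (s 1) (M 1) w q
  qE (M3 1 h1) cB1.
exists (fun i => if i == 0 then set0 else B i), (fun i => if i == 1 then Bs1 else Bs i).
split=> // [i k i1 ik kh|i hi|i hi].
- rewrite !ifN; try lia.
  have [|BXi _] := hB i; first by lia.
  have [|BXk _] := hB k; first by lia.
  apply: disjointWl BXi _; apply: disjointWr BXk _; exact: dX.
- rewrite [if i == 0 then _ else _]ifN; last by lia.
  case: eqP => [->|ni]; first by [].
  by apply: hBs; lia.
- rewrite [if i == 0 then _ else _]ifN; last by lia.
  have [->|ni] := eqVneq i 1.
    exists (B 1); split; rewrite ?sub0set //.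
    by rewrite cB1; apply: leq_trans (cU 1) _; lia.
  rewrite [if i.-1 == 0 then _ else _]ifN; last by lia.
  by apply: hU; lia.
Qed.

End Levels.

Local Open Scope ring_scope.

(** * Real parameters *)

(** Inside the [Delta]-th power the left side is at most [19602 * q ^+ 9 * m * s ^+ 2], where
    [19602 = 121 * 2 * 81]. Substituting [c = q ^+ 30 * s / m] makes the right side at least
    [q ^+ 15 / 18] times [q ^+ 9 * m * s ^+ 2], which is larger since [3 <= q]. *)
Lemma error_estimate (R : realFieldType) (Delta : nat) (c q m s M u p bad ck : R) :
  0 < c -> 0 < s -> 3 <= q -> c * m = q ^+ 30 * s ->
  m <= M -> M <= 2 * m -> m / 9 <= p -> 0 <= u -> u <= 121 * q ^+ 9 * M -> 0 <= ck ->
  bad * (M ^+ 2 * p) ^+ Delta <= ck * (u * (81 * s ^+ 2)) ^+ Delta ->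
  bad <= c ^+ Delta * (s / (2 * (q ^+ 6 * m))) ^+ Delta * ck.
Proof.
move=> c0 s0 q3 cm mM M2 mp u0 uM ck0 hbad.
have q0 : 0 < q by lra.
have m0 : 0 < m by rewrite -(pmulr_rgt0 _ c0) cm mulr_gt0 // exprn_gt0.
have M0 : 0 < M by lra.
have p0 : 0 < p by lra.
have Mp0 : 0 < (M ^+ 2 * p) ^+ Delta by rewrite exprn_gt0 // mulr_gt0 // exprn_gt0.
rewrite -(ler_pM2r Mp0); apply: le_trans hbad _.
rewrite [_ * ck]mulrC -mulrA ler_wpM2l // -!exprMn lerXn2r ?nnegrE //.
- by rewrite mulr_ge0 // mulr_ge0 // exprn_ge0 // ltW.
- by rewrite !mulr_ge0 ?invr_ge0 ?mulr_ge0 ?exprn_ge0 //; lra.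
have cE : c = q ^+ 30 * s / m by rewrite -cm mulfK // gt_eqF.
have h1 : u * (81 * s ^+ 2) <= 19602 * q ^+ 9 * m * s ^+ 2.
  have q9 : 0 < q ^+ 9 by rewrite exprn_gt0.
  have h : u <= 242 * q ^+ 9 * m.
    apply: le_trans uM _; have := ler_wpM2l (ltW q9) M2; lra.
  have := ler_wpM2r (ltW (exprn_gt0 2 s0)) h; lra.
apply: le_trans h1 _.
have h2 : m ^+ 3 / 9 <= M ^+ 2 * p.
  have m0' := ltW m0; rewrite exprSr -mulrA; apply: ler_pM => //.
  - by rewrite exprn_ge0.
  - by rewrite divr_ge0.
  - by rewrite lerXn2r ?nnegrE // ltW.
have T0 : 0 <= c * (s / (2 * (q ^+ 6 * m))).
  by rewrite mulr_ge0 ?divr_ge0 ?mulr_ge0 ?exprn_ge0 // ?ltW.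
apply: le_trans (ler_wpM2l T0 h2).
have -> : c * (s / (2 * (q ^+ 6 * m))) * (m ^+ 3 / 9) = q ^+ 15 / 18 * (q ^+ 9 * m * s ^+ 2).
  rewrite cE; field; rewrite ?gt_eqF //.
have h3 : 0 <= q ^+ 9 * m * s ^+ 2 by rewrite !mulr_ge0 ?exprn_ge0 // ltW.
have h4 : 19602 <= q ^+ 15 / 18.
  have a27 : 27 <= q ^+ 3 by rewrite !exprS expr0; nra.
  rewrite (_ : q ^+ 15 / 18 = (q ^+ 3 * q ^+ 3 * q ^+ 3) * (q ^+ 3 * q ^+ 3 / 18)); last by field.
  move: (q ^+ 3) a27 => a a27.
  have a2 : 729 <= a * a by nra.
  have a3 : 19602 <= a * a * a by nra.
  nra.
have := ler_wpM2r h3 h4; lra.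
Qed.

Lemma subset_of_chain (T : finType) (A : nat -> {set T}) (w j : nat) :
  (forall i, (i < w)%N -> A i \subset A i.+1) -> (j <= w)%N -> A j \subset A w.
Proof.
move=> hA jw; rewrite -(subKn jw); move: (w - j)%N (leq_subr j w) => d.
elim: d => [|d IH] dw; first by rewrite subn0.
apply: subset_trans (IH _); last by lia.
have := hA (w - d.+1)%N; rewrite (_ : (w - d.+1).+1 = w - d)%N; last by lia.
by apply; lia.
Qed.

(** * The constants of one level and their integer counterparts *)

Section Constants.
Variables (R : realType) (delta : R) (Delta w s : nat).
Hypotheses (Delta_gt0 : (0 < Delta)%N) (w_gt0 : (0 < w)%N) (s_gt0 : (0 < s)%N).
Hypotheses (delta_gt0 : 0 < delta) (delta_lt1 : delta < 1).

Local Notation root := (delta `^ (Delta%:R)^-1).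
Local Notation q := (3 ^+ (Delta * w) : R).
Local Notation m := (m_of delta Delta w s).

Lemma root_mul_m_of : root * m = q ^+ 30 * s%:R.
Proof.
have c0 : root != 0 by rewrite gt_eqF // powR_gt0.
rewrite /m_of powRN -exprM mulrA mulrA mulfV // mul1r; congr (3 ^+ _ * _); lia.
Qed.

Lemma root_expn : root ^+ Delta = delta.
Proof.
rewrite -powR_mulrn ?powR_ge0 // -powRrM mulVf ?powRr1 ?ltW //.
by rewrite pnatr_eq0 -lt0n.
Qed.

Lemma base_ge3 : 3 <= q.
Proof. by rewrite -[X in X <= _]expr1 ler_eXn2l ?ltr1n // muln_gt0 Delta_gt0. Qed.

Lemma m_of_lower : q ^+ 30 * s%:R <= m.
Proof.
have c1 : root <= 1.
  rewrite -[X in _ <= X](powRr0 delta); apply: ger_powR; first by rewrite delta_gt0 ltW.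
  by rewrite invr_ge0.
have m0 : 0 <= m by rewrite !mulr_ge0 ?powR_ge0 ?exprn_ge0.
by rewrite -root_mul_m_of ler_piMl.
Qed.

Lemma expr_ge_base (n : nat) : (0 < n)%N -> q <= q ^+ n.
Proof.
move=> n0; rewrite -[X in X <= _]expr1 ler_weXn2l //.
by apply: le_trans base_ge3; rewrite ler1n.
Qed.

Lemma m_of_ge_base : 9 * q <= m.
Proof.
apply: le_trans m_of_lower; have q3 := base_ge3.
have s1 : 1 <= s%:R :> R by rewrite ler1n.
have q28 : q <= q ^+ 28 by apply: expr_ge_base.
have : q ^+ 30 * 1 <= q ^+ 30 * s%:R by rewrite ler_wpM2l ?exprn_ge0.
rewrite mulr1; apply: le_trans.
rewrite (_ : q ^+ 30 = q ^+ 28 * (q * q)); last by rewrite -expr2 -exprD.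
move: (q ^+ 28) q28 => a qa; move: q q3 qa => b b3 ba; nra.
Qed.

Lemma Delta_lt_base : Delta.+1%:R <= q.
Proof.
rewrite -natrX ler_nat; apply: leq_trans (ltn_expl Delta (isT : (1 < 3)%N)) _.
by rewrite leq_exp2l // leq_pmulr.
Qed.

(** The integer that stands for the real [m] in the counting lemmas; it lies between [m] and
    [2 * m]. *)
Local Notation M := (Num.truncn m).+1.

Lemma m_of_le_ceil : m <= M%:R.
Proof. exact/ltW/truncnS_gt. Qed.

Lemma ceil_le_m_of : M%:R <= 2 * m.
Proof.
have := base_ge3; have := m_of_ge_base => h1 h2.
have : (Num.truncn m)%:R <= m by rewrite truncn_le; lra.
rewrite -natr1; lra.
Qed.

Lemma ceil_gt_s : (s < M)%N.
Proof.
have h : s%:R <= m.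
  apply: le_trans m_of_lower; rewrite ler_peMl //; apply: exprn_ege1.
  by apply: le_trans base_ge3; rewrite ler1n.
rewrite -(ltr_nat R); exact: le_lt_trans h (truncnS_gt _).
Qed.

Lemma ceil_ge_Delta : (Delta.+2 < M)%N.
Proof.
rewrite -(ltr_nat R); apply: le_lt_trans (truncnS_gt _).
have := base_ge3; have := m_of_ge_base; have := Delta_lt_base.
rewrite -natr1; lra.
Qed.

(** Rounding and subtracting [Delta] cost at most [Delta + 1], which is at most [q] and so at most
    [m / 9]. *)
Lemma third_m_of_sub : m / 9 <= (Num.truncn (m / 3) - Delta)%:R.
Proof.
have h1 := truncnS_gt (m / 3); have h2 := base_ge3; have h3 := m_of_ge_base.
have h4 := Delta_lt_base.
have Dk : (Delta <= Num.truncn (m / 3))%N.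
  rewrite truncn_ge_nat; last by lra.
  by move: h4; rewrite -[Delta.+1%:R]natr1; lra.
rewrite natrB //; move: h1 h4; rewrite -[Delta.+1%:R]natr1 -[(Num.truncn _).+1%:R]natr1; lra.
Qed.

(** With blocks of [2 * Delta] choices the surviving fraction is [(81 * s ^ 2 / M ^ 2) ^ Delta].
    [bin_ratio] replaces the binomial coefficient over [#|U|] by the one over [m / 3], at the price
    of another [Delta]-th power, and [error_estimate] compares the bases of these powers. *)
Lemma nested_out_community (V : finType) (E : rel V) (W U : {set V}) (Bs : nat -> {set V})
    (j : nat) :
  (#|U| <= 121 * (3 ^ (Delta * w)) ^ 9 * M)%N -> W \subset U -> Bs w \subset U -> (j < w)%N ->
  nested_communities E Delta s (2 * Delta) M w U W Bs ->
  out_community E (W :|: Bs j) set0 (Bs j.+1) Delta s (err_of delta Delta w s).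
Proof.
move=> hU WU BU jw [hM hsub hbad].
have out0 (Q : {set V}) : common_out E set0 :&: Q = Q.
  by apply/setP => v; rewrite in_setI; case: (v \in Q); rewrite ?andbF ?andbT //;
     apply/common_outP => u; rewrite inE.
have subU k : (k <= w)%N -> Bs k \subset U.
  by move=> kw; apply: subset_trans BU; apply: subset_of_chain hsub kw.
split.
- by rewrite out0 addn1; apply: leq_trans ceil_gt_s (hM _ _).
- rewrite setD0; apply: leq_trans (_ : #|Bs j| <= _)%N; last exact/subset_leq_card/subsetUr.
  by apply: leq_trans (hM j _); [have := ceil_ge_Delta; lia|lia].
set bad := [set S | _].
have {}hbad : (#|bad| * M ^ (2 * Delta) <= 'C(#|U|, Delta) * (9 * s) ^ (2 * Delta))%N.
  apply: leq_trans (hbad j jw); rewrite leq_mul2r; apply/orP; right.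
  apply/subset_leq_card/subsetP => S; rewrite !in_set setD0 set0U addn1 -leqNgt.
  move=> /and3P[SW -> ->]; rewrite SW !andbT.
  by apply: subset_trans SW _; rewrite subUset WU subU // ltnW.
set k := Num.truncn (m / 3); have third := third_m_of_sub; rewrite -/k in third.
have Dk : (k - Delta + Delta <= k)%N.
  have m9 : 0 < m / 9 by have := m_of_ge_base; have := base_ge3; lra.
  have : (0 < k - Delta)%N by rewrite -(ltr_nat R); apply: lt_le_trans third.
  lia.
have hbin := bin_ratio #|U| Dk.
have final : (#|bad| * (M ^ 2 * (k - Delta)) ^ Delta
    <= 'C(k, Delta) * (#|U| * (81 * s ^ 2)) ^ Delta)%N.
  have -> : (81 * s ^ 2 = (9 * s) ^ 2)%N by ring.
  rewrite (expnMn (M ^ 2)) (expnMn #|U|) -!(expnM _ 2) mulnA [(#|U| ^ _ * _)%N]mulnC.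
  apply: leq_trans (leq_mul hbad (leqnn _)) _.
  by rewrite mulnAC mulnCA mulnC leq_mul2l hbin orbT.
rewrite /err_of -[X in X * _ * _]root_expn.
have s0 : 0 < s%:R :> R by rewrite ltr0n.
rewrite /b_of (_ : 3 ^+ (6 * Delta * w) = q ^+ 6); last by rewrite -exprM; congr (_ ^+ _); lia.
have := @error_estimate R Delta root q m s%:R M%:R #|U|%:R (k - Delta)%:R #|bad|%:R 'C(k, Delta)%:R.
apply => //.
- exact: powR_gt0.
- exact: base_ge3.
- exact: root_mul_m_of.
- exact: m_of_le_ceil.
- exact: ceil_le_m_of.
- by rewrite -!natrX -!natrM ler_nat.
- by rewrite -!natrX -!natrM -!natrX -!natrM ler_nat.
Qed.

(** The windows need [5760 * q ^+ 9 * M] vertices, while [a_of] equals [q ^+ 16 * m]; the spare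
    factor [q ^+ 7] is at least 2187. *)
Lemma six_a_of_ge : (96 * (60 * (3 ^ (Delta * w)) ^ 9 * M))%:R <= 6 * a_of delta Delta w s.
Proof.
have -> : a_of delta Delta w s = q ^+ 7 * (q ^+ 9 * m).
  rewrite mulrA -exprD -exprM /a_of /b_of mulrA -exprD; congr (3 ^+ _ * _); lia.
have M2 := ceil_le_m_of.
have -> : (96 * (60 * (3 ^ (Delta * w)) ^ 9 * M))%:R = 5760 * (q ^+ 9 * M%:R) :> R.
  by rewrite !natrM !natrX; ring.
have q0 : 0 <= q ^+ 9 by rewrite exprn_ge0 // exprn_ge0.
have h1 := ler_wpM2l q0 M2.
have m0 : 0 <= m by have := m_of_ge_base; have := base_ge3; lra.
have q7 : 2187 <= q ^+ 7.
  have q3 := base_ge3; move: q q3 => b b3.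
  have b2 : 27 <= b ^+ 3 by rewrite !exprS expr0; nra.
  rewrite (_ : b ^+ 7 = b ^+ 3 * b ^+ 3 * b); last by ring.
  have b6 : 729 <= b ^+ 3 * b ^+ 3 by nra.
  nra.
have h0 := mulr_ge0 q0 m0; have h2 := ler_wpM2r h0 q7.
move: (q ^+ 7) (q ^+ 9) h0 h1 h2 => a b; lra.
Qed.

Lemma sq_ceil_le_b_of : ((3 ^ (Delta * w)) ^ 2 * M)%:R <= b_of delta Delta w s.
Proof.
rewrite /b_of (_ : 3 ^+ (6 * Delta * w) = q ^+ 6); last by rewrite -exprM; congr (_ ^+ _); lia.
have M2 := ceil_le_m_of; have q3 := base_ge3.
have m0 : 0 <= m by have := m_of_ge_base; lra.
rewrite natrM !natrX; apply: le_trans (ler_wpM2l _ M2) _; first by rewrite exprn_ge0 // exprn_ge0.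
rewrite mulrA ler_wpM2r // (_ : q ^+ 6 = q ^+ 2 * q ^+ 4); last by rewrite -exprD.
rewrite ler_wpM2l ?exprn_ge0 //.
by apply: le_trans (expr_ge_base (isT : (0 < 4)%N)); lra.
Qed.

End Constants.

(** As [x] is strictly below the integer [2 * (truncn y).+1], rounding it up to the next integer
    does not pass that value. For negative [x], [truncn x] is 0. *)
Lemma ceil_double (R : realType) (x y : R) : 0 <= y -> x <= 2 * y ->
  ((Num.truncn x).+1 <= 2 * (Num.truncn y).+1)%N.
Proof.
move=> y0 xy; rewrite -(ler_nat R) natrM.
have [x0|x0] := leP 0 x; last first.
  rewrite (_ : Num.truncn x = 0%N) -?natrM ?ler1n //.
  by apply/eqP; rewrite -leqn0 truncn_le_nat; lra.
rewrite -natrM ler_nat truncn_lt_nat // natrM.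
by apply: le_lt_trans xy _; rewrite ltr_pM2l // truncnS_gt.
Qed.

Theorem theorem2p10 (R : realType) (Delta w h : nat) (s : nat -> nat)
  (delta : R) (V : finType) (E : rel V)
  (Delta_gt0 : (0 < Delta)%N)
  (s_gt0 : forall i : nat, (1 <= i <= h)%N -> (0 < s i)%N)
  (s_prev : forall i : nat, (1 < i <= h)%N -> (s i.-1)%:R / 2 <= (s i)%:R :> R)
  (s_next : forall i : nat, (1 <= i < h)%N -> (s i.+1)%:R / 2 <= (s i)%:R :> R)
  (delta_gt0 : 0 < delta) (delta_lt1 : delta < 1)
  (tournE : tournament E)
  (card_V : \sum_(1 <= i < h.+1) 6 * a_of delta Delta w (s i) <= #|V|%:R) :
  exists (B : nat -> {set V}) (Bs : nat -> nat -> {set V}),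
    [/\ B 0%N = set0,
        forall i k : nat, (1 <= i <= h)%N -> (1 <= k <= h)%N -> i != k ->
          [disjoint B i & B k],
        forall i : nat, (1 <= i <= h)%N ->
          (forall j : nat, (j < w)%N -> Bs i j \subset Bs i j.+1)
          /\ Bs i w \subset B i
      & forall i j : nat, (1 <= i <= h)%N -> (1 <= j <= w)%N ->
          (m_of delta Delta w (s i) <= #|Bs i j|%:R <= b_of delta Delta w (s i))
          /\ out_community E (B i.-1 :|: Bs i j.-1) set0 (Bs i j) Delta (s i)
               (err_of delta Delta w (s i))].
Proof.
have [w0|w0] := posnP w.
  (* For [w = 0] no index [j] carries a size or community condition, so empty sets will do. *)
  exists (fun=> set0), (fun _ _ => set0); split=> //.
  - by move=> i k _ _ _; rewrite -setI_eq0 set0I.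
  - by move=> i j _; rewrite w0; lia.
pose M i := (Num.truncn (m_of delta Delta w (s i))).+1.
have m_double i : (1 <= i < h)%N ->
    m_of delta Delta w (s i) <= 2 * m_of delta Delta w (s i.+1).
  move=> hi; rewrite /m_of mulrCA ler_wpM2l ?mulr_ge0 ?powR_ge0 ?exprn_ge0 //.
  have hi' : (1 < i.+1 <= h)%N by lia.
  by have := s_prev _ hi'; rewrite /=; lra.
have [|||B [Bs [B0 dB hB hU]]] := @community_levels V E tournE Delta w h _ s M erefl Delta_gt0 w0.
- move=> i /s_gt0 si.
  by have := ceil_ge_Delta Delta_gt0 w0 si delta_gt0 delta_lt1; rewrite /M; lia.
- move=> i hi; apply: ceil_double (m_double i hi).
  by rewrite !mulr_ge0 ?powR_ge0 ?exprn_ge0.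
- rewrite -(ler_nat R); apply: le_trans card_V; rewrite natr_sum !big_nat.
  by apply: ler_sum => i /s_gt0 si; apply: six_a_of_ge.
exists B, Bs; split=> //.
- move=> i k hi hk; rewrite neq_ltn => /orP[] ik; first by apply: dB; lia.
  by rewrite disjoint_sym; apply: dB; lia.
- move=> i hi; have [U [_ _ _ [_ hsub _]]] := hU i hi.
  by split; [exact: hsub | exact: (hB i hi).1].
move=> i j hi hj; have [U [BU BiU cU hn]] := hU i hi; have si := s_gt0 i hi.
have [BsB cBs] := hB i hi.
have [hM hsub _] := hn.
have BsU : Bs i w \subset U := subset_trans BsB BiU.
split.
  apply/andP; split.
    by apply: le_trans (m_of_le_ceil _ _ _ _) _; rewrite ler_nat; apply: hM; lia.
  apply: le_trans (sq_ceil_le_b_of Delta_gt0 w0 si delta_gt0 delta_lt1).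
  by rewrite ler_nat -cBs; apply/subset_leq_card/(subset_of_chain hsub); lia.
have := nested_out_community Delta_gt0 w0 si delta_gt0 delta_lt1 cU BU BsU _ hn.
by move=> /(_ j.-1); rewrite prednK; [apply; lia|lia].
Qed.
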